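(* For every integer $j \geq 3$, $$m_j(B, K_{1,3}) = \begin{cases} 4 & \text{if } j = 3,\\ 3 & \text{if } j = 4,\\ 2 & \text{if } j \in \{5,6\},\\ 1 & \text{otherwise.}\end{cases}$$
   Context: All graphs are simple. $K_{j\times s}$ denotes the complete multipartite graph with $j$ partite sets, each of size $s$. The Butterfly graph $B$ is the graph on 5 vertices consisting of two copies of the triangle $C_3$ sharing exactly one common vertex. $K_{1,3}$ is the star with three edges. For graphs $B$ and $G$ and an integer $j\ge 2$, the size multipartite Ramsey number $m_j(B,G)$ is the smallest natural number $s$ such that every colouring of the edges of $K_{j\times s}$ with two colours, red and blue, contains a red copy of $B$ or a blue copy of $G$; if no such $s$ exists, $m_j(B,G)=\infty$. *)

(* Defs.v *)
From mathcomp Require Import all_boot.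
From mathcomp Require Import boolp.

Set Implicit Arguments.
Unset Strict Implicit.
Unset Printing Implicit Defensive.

Record sgraph := SGraph {
  vertex :> finType;
  adj : rel vertex;
  adj_sym : symmetric adj;
  adj_irr : irreflexive adj }.

(* Copies are not required to be induced. *)
Definition contains_copy (H G : sgraph) : bool :=
  [exists f : {ffun H -> G},
    injectiveb f && [forall x, forall y, adj x y ==> adj (f x) (f y)]].

Section ColourClass.
Variables (G : sgraph) (c : {ffun {set G} -> bool}) (b : bool).

Definition colour_rel : rel G := fun x y => adj x y && (c [set x; y] == b).

Fact colour_rel_sym : symmetric colour_rel.
Proof. by move=> x y; rewrite /colour_rel adj_sym setUC. Qed.

Fact colour_rel_irr : irreflexive colour_rel.
Proof. by move=> x; rewrite /colour_rel adj_irr. Qed.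

Definition colour_class := SGraph colour_rel_sym colour_rel_irr.
End ColourClass.

(* A 2-colouring of the edges of G (true = red, false = blue) is given by a
   function on all vertex sets; only its values on the edges [set x; y] of G
   play a role. *)
Definition arrows (G H1 H2 : sgraph) : bool :=
  [forall c : {ffun {set G} -> bool},
    contains_copy H1 (colour_class c true)
    || contains_copy H2 (colour_class c false)].

Section CompleteMultipartite.
Variables j s : nat.

Definition cmp_rel : rel ('I_j * 'I_s) := fun u v => u.1 != v.1.

Fact cmp_rel_sym : symmetric cmp_rel.
Proof. by move=> u v; rewrite /cmp_rel eq_sym. Qed.

Fact cmp_rel_irr : irreflexive cmp_rel.
Proof. by move=> u; rewrite /cmp_rel eqxx. Qed.

Definition complete_multipartite := SGraph cmp_rel_sym cmp_rel_irr.
End CompleteMultipartite.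

(* None stands for infinity. *)
Definition multipartite_ramsey (j : nat) (H1 H2 : sgraph) : option nat :=
  if pselect (exists s, arrows (complete_multipartite j s) H1 H2) is left ex_s
  then Some (ex_minn ex_s) else None.

Section Butterfly.

Definition butterfly_edges : seq (nat * nat) :=
  [:: (0, 1); (0, 2); (1, 2); (0, 3); (0, 4); (3, 4)].

Definition butterfly_rel : rel 'I_5 := fun x y =>
  ((x : nat, y : nat) \in butterfly_edges)
  || ((y : nat, x : nat) \in butterfly_edges).

Fact butterfly_rel_sym : symmetric butterfly_rel.
Proof. by move=> x y; rewrite /butterfly_rel orbC. Qed.

Fact butterfly_rel_irr : irreflexive butterfly_rel.
Proof. by case=> [[|[|[|[|[|]]]]]]. Qed.

Definition butterfly := SGraph butterfly_rel_sym butterfly_rel_irr.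
End Butterfly.

Section Star.
Variable n : nat.

Definition star_rel : rel 'I_n.+1 := fun x y => (x == ord0) != (y == ord0).

Fact star_rel_sym : symmetric star_rel.
Proof. by move=> x y; rewrite /star_rel eq_sym. Qed.

Fact star_rel_irr : irreflexive star_rel.
Proof. by move=> x; rewrite /star_rel eqxx. Qed.

Definition star := SGraph star_rel_sym star_rel_irr.
End Star.

(* Main.v *)
(** A colouring without a blue [K_{1,3}] is one whose blue degrees are at most
    2, so every vertex of [K_{j x s}] has at most [t = s + 2] non-neighbours in
    the red graph, itself included.  A red butterfly centred at [v] is a
    matching of size 2 in the link of [v] (the red graph on the red
    neighbourhood of [v]).  If [j s >= 2 t + 2], the link has minimum degree at
    least 1 and cannot be a star, because the leaves of a star are pairwise
    non-adjacent; as a graph on at least 4 vertices it then has such a matching.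
    In [K_7] the link may be a star, and then its leaves are red to everything
    else, which yields a butterfly with another centre.  In [K_{3 x 4}] the
    link is bipartite with at most 2 non-edges at each vertex and at least 6
    vertices.  For the lower bounds, [K_5], [K_6] and [K_{4 x 2}] have
    colourings with a bipartite red graph, and in [K_{3 x 3}] one takes a blue
    4-cycle together with a disjoint blue path on the other 5 vertices. *)
Require Import Defs.
From mathcomp Require Import all_boot.
From mathcomp Require Import boolp zify.

Set Implicit Arguments.
Unset Strict Implicit.
Unset Printing Implicit Defensive.

(** * Copies of graphs and monotonicity of the arrow relation *)

Lemma contains_copyP (H G : sgraph) :
  reflect (exists f : H -> G,
             injective f /\ forall x y, adj x y -> adj (f x) (f y))
          (contains_copy H G).
Proof.
apply: (iffP existsP) => [[f /andP[/injectiveP injf /forallP homf]]|].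
  by exists f; split=> // x y; move/forallP/(_ y)/implyP: (homf x).
case=> f [injf homf]; exists [ffun x => f x]; apply/andP; split.
  by apply/injectiveP => x y; rewrite !ffunE => /injf.
by apply/forallP => x; apply/forallP => y; apply/implyP; rewrite !ffunE => /homf.
Qed.

(** A colouring of [G'] pulls back along the embedding to one of [G], and a monochromatic copy found
    there is pushed forward. *)
Lemma arrows_mono (G G' H1 H2 : sgraph) :
  contains_copy G G' -> arrows G H1 H2 -> arrows G' H1 H2.
Proof.
move=> /contains_copyP[f [injf homf]] /forallP arrG.
apply/forallP => c'; move: (arrG [ffun S : {set G} => c' (f @: S)]).
have copy H b :
    contains_copy H (colour_class [ffun S : {set G} => c' (f @: S)] b) ->
    contains_copy H (colour_class c' b).
  move=> /contains_copyP[g [injg homg]]; apply/contains_copyP.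
  exists (f \o g); split=> [|x y /homg]; first exact: inj_comp.
  rewrite /adj /= /colour_rel ffunE => /andP[/homf].
  by rewrite imsetU1 imset_set1 => -> /=.
by case/orP => /copy ->; rewrite ?orbT.
Qed.

Lemma complete_multipartite_mono j s j' s' :
  j <= j' -> s <= s' ->
  contains_copy (complete_multipartite j s) (complete_multipartite j' s').
Proof.
move=> lej les; apply/contains_copyP.
exists (fun u : 'I_j * 'I_s => (widen_ord lej u.1, widen_ord les u.2)).
split=> [[x1 x2] [y1 y2] [e1 e2]|//].
by congr pair; apply: val_inj.
Qed.

(** By monotonicity in the part size, failure at [s] excludes every smaller size as well. *)
Lemma multipartite_ramsey_eq j s (H1 H2 : sgraph) :
  arrows (complete_multipartite j s.+1) H1 H2 ->
  ~~ arrows (complete_multipartite j s) H1 H2 ->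
  multipartite_ramsey j H1 H2 = Some s.+1.
Proof.
move=> arrS narr; rewrite /multipartite_ramsey.
case: pselect => [ex_s|[]]; last by exists s.+1.
case: ex_minnP => m arrm minm; congr Some; apply/anti_leq.
rewrite minm //= ltnNge; apply: contra narr => lems.
exact: arrows_mono (complete_multipartite_mono (leqnn j) lems) arrm.
Qed.

(** * Butterflies and stars described by their vertices *)

Definition butterfly_at (T : Type) (r : rel T) (v a b c d : T) : bool :=
  [&& r v a, r v b, r a b, r v c, r v d & r c d].

(** The four inequalities separate the two triangles; adjacent vertices are distinct by
    irreflexivity. *)
Lemma butterfly_copyP (G : sgraph) :
  (exists v a b c d : G,
     butterfly_at (@adj G) v a b c d && [&& a != c, a != d, b != c & b != d]) <->
  contains_copy butterfly G.
Proof.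
split=> [[v [a [b [c [d]]]]]|].
  have nadj (x y : G) : adj x y -> x != y.
    by apply: contraTneq => ->; rewrite adj_irr.
  case/andP => /andP[va /and5P[vb ab vc vd cd]] /and4P[ac ad bc bd].
  apply/contains_copyP.
  exists (fun i : 'I_5 => nth v [:: v; a; b; c; d] i); split=> [x y /eqP|].
    rewrite nth_uniq ?ltn_ord //; first by move/eqP/val_inj.
    by rewrite /= !inE !negb_or ac ad bc bd !nadj.
  have sadj (x y : G) : adj x y -> adj y x by rewrite adj_sym.
  by case=> [[|[|[|[|[|//]]]]] ltx] [[|[|[|[|[|//]]]]] lty] //= _; apply: sadj.
case/contains_copyP => f [injf homf].
pose o k (ltk : k < 5) := f (Ordinal ltk).
exists (o 0 isT), (o 1 isT), (o 2 isT), (o 3 isT), (o 4 isT).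
by rewrite /o !inj_eq //= /butterfly_at !homf.
Qed.

Lemma star_copyP (G : sgraph) n :
  (exists v : G, n <= #|[set u | adj v u]|) <-> contains_copy (star n) G.
Proof.
split=> [[v len]|/contains_copyP[f [injf homf]]].
  apply/contains_copyP; pose s := v :: enum [set u | adj v u].
  have sz (i : 'I_n.+1) : i < size s.
    by rewrite /= -cardE; apply: leq_trans (ltn_ord i) _.
  have adjs (i : 'I_n.+1) : i != ord0 -> adj v (nth v s i).
    case: i (sz i) => [[|i] lti] // szi _.
    by have := mem_nth v (szi : i < size (enum _)); rewrite mem_enum inE.
  exists (fun i : 'I_n.+1 => nth v s i); split=> [x y /eqP|x y].
    rewrite nth_uniq //=; first by move/eqP/val_inj.
    by rewrite mem_enum inE adj_irr enum_uniq.
  rewrite {1}/adj /= /star_rel.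
  have [->|x0] := eqVneq x ord0; have [->|y0] //= := eqVneq y ord0 => _.
    exact: adjs.
  by rewrite adj_sym adjs.
exists (f ord0); rewrite -[X in X <= _]card_ord.
have inj : injective (fun i : 'I_n => f (lift ord0 i)).
  by move=> i k /injf/lift_inj.
rewrite -(card_imset _ inj) subset_leq_card //.
by apply/subsetP => _ /imsetP[i _ ->]; rewrite inE homf.
Qed.

(** * Butterflies in graphs with few non-neighbours *)

Lemma exists_notin (T : finType) (A : {pred T}) (B : {set T}) :
  #|A| < #|B| -> exists2 x, x \in B & x \notin A.
Proof.
move=> ltAB; apply/subsetPn; apply: contraTN ltAB => /subset_leq_card.
by rewrite leqNgt.
Qed.

Lemma exists_notin_seq (T : finType) (s : seq T) (A : {set T}) :
  size s < #|A| -> exists2 x, x \in A & x \notin s.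
Proof.
by move=> lt; apply: exists_notin; apply: leq_ltn_trans (card_size s) _.
Qed.

Section NonNeighbours.
Variables (T : finType) (r : rel T).
Hypotheses (r_sym : symmetric r) (r_irr : irreflexive r).

Definition has_butterfly := exists v a b c d,
  butterfly_at r v a b c d && [&& a != c, a != d, b != c & b != d].

(** Pairwise intersecting edges form a star or a triangle. A triangle would leave a fourth vertex,
    whose edge misses one of its sides. *)
Lemma matching_or_star (N : {set T}) :
  4 <= #|N| -> {in N, forall x, exists2 y, y \in N & r x y} ->
  (exists a b c d, [/\ [&& a \in N, b \in N, c \in N & d \in N],
     r a b, r c d & [&& a != c, a != d, b != c & b != d]]) \/
  (exists2 a, a \in N & {in N :\ a &, forall x y, ~~ r x y}).
Proof.
move=> N4 nbr; pose matching := exists a b c d,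
  [/\ [&& a \in N, b \in N, c \in N & d \in N],
     r a b, r c d & [&& a != c, a != d, b != c & b != d]].
have [|nom] := pselect matching; [by left|right].
have {}nom a b c d : a \in N -> b \in N -> c \in N -> d \in N ->
    r a b -> r c d -> ~~ [&& a != c, a != d, b != c & b != d].
  move=> aN bN cN dN ab cd; apply/negP => dist; apply: nom.
  by exists a, b, c, d; rewrite aN bN cN dN.
have nadj u w : r u w -> u != w by apply: contraTneq => ->; rewrite r_irr.
(* The middle vertex [x] of a path [p], [x], [y] is the centre of the star. *)
have star x y p : x \in N -> y \in N -> p \in N -> r x y -> r p x ->
    p != y -> exists2 a, a \in N & {in N :\ a &, forall u w, ~~ r u w}.
  move=> xN yN pN xy px py; have px' := nadj _ _ px; have xy' := nadj _ _ xy.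
  have noy z : z \in N -> z != p -> z != x -> z != y -> ~~ r z y.
    move=> zN zp zx zy; apply/negP => rzy.
    by have /negP[] := nom z y p x zN yN pN xN rzy px;
      rewrite zp zx (eq_sym y) py (eq_sym y).
  (* This excludes the triangle: an edge from a fourth vertex [q] to [x] misses [p y], one to [y]
     misses [p x], and any other misses [x y]. *)
  have nopy : ~~ r p y.
    apply/negP => rpy.
    have [q qN] : exists2 q, q \in N & q \notin [:: x; y; p].
      by apply: exists_notin_seq; apply: leq_trans N4.
    rewrite !inE !negb_or => /and3P[qx qy qp]; have [w wN qw] := nbr q qN.
    have wx : w != x.
      apply/eqP => wx; have /negP[] := nom q w p y qN wN pN yN qw rpy.
      by rewrite qp qy wx (eq_sym x) px'.
    have wy : w != y by apply: contraNneq (noy q qN qp qx qy) => <-.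
    by have /negP[] := nom q w x y qN wN xN yN qw xy; rewrite qx qy wx.
  have {nopy}noy z : z \in N -> z != x -> z != y -> ~~ r z y.
    by have [->|zp] := eqVneq z p => // *; apply: noy.
  exists x => // u w /setD1P[ux uN] /setD1P[wx wN]; apply/negP => uw.
  have uy : u != y.
    apply: contraTneq (uw) => uy; rewrite r_sym uy noy // -uy eq_sym.
    exact: nadj.
  have wy : w != y by apply: contraNneq (noy u uN ux uy) => <-.
  by have /negP[] := nom u w x y uN wN xN yN uw xy; rewrite ux uy wx.
have [x xN] : exists x, x \in N by apply/card_gt0P; apply: leq_trans N4.
have [y yN xy] := nbr x xN; have [p pN] : exists2 p, p \in N & p \notin [:: x; y].
  by apply: exists_notin_seq; apply: leq_trans N4.
rewrite !inE negb_or => /andP[px py]; have [w wN pw] := nbr p pN.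
have [wx|wx] := eqVneq w x; first by apply: (star x y p) => //; rewrite -wx.
have [wy|wy] := eqVneq w y.
  by apply: (star y x p) => //; rewrite ?(r_sym y) // -wy.
by have /negP[] := nom p w x y pN wN xN yN pw xy; rewrite px py wx.
Qed.

(** Any [t.+1] vertices contain a neighbour of any given vertex. The link has at least [t.+2]
    vertices, so removing the centre of a star still leaves enough of them to contain an edge. *)
Lemma butterfly_many t :
  (forall x, #|[set y | ~~ r x y]| <= t) -> 2 <= t -> t.*2.+2 <= #|T| ->
  has_butterfly.
Proof.
move=> nr2 t2 T2.
have [v _] : exists v : T, v \in T by apply/card_gt0P; apply: leq_trans T2.
pose N := [set y | r v y].
have cardN : t.+2 <= #|N|.
  have := cardsC N; have := nr2 v; rewrite (_ : [set y | _] = ~: N); first lia.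
  by apply/setP => y; rewrite !inE.
have outside x (A : {set T}) : t < #|A| -> exists2 y, y \in A & r x y.
  move=> ltA; have [y yA] := exists_notin (leq_ltn_trans (nr2 x) ltA).
  by rewrite inE negbK; exists y.
case: (@matching_or_star N); first lia.
- by move=> x _; apply: outside; apply: ltnW.
- move=> [a [b [c [d [/and4P[]]]]]]; rewrite !inE => va vb vc vd ab cd dist.
  by exists v, a, b, c, d; rewrite dist /butterfly_at va vb vc vd ab cd.
case=> a aN ind; have cardL : t < #|N :\ a| by have := cardsD1 a N; lia.
have [x xL] : exists x, x \in N :\ a by apply/card_gt0P; lia.
by have [y yL xy] := outside x _ cardL; have := ind x y xL yL; rewrite xy.
Qed.

Lemma butterfly_seven :
  (forall x, #|[set y | ~~ r x y]| <= 3) -> #|T| = 7 -> has_butterfly.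
Proof.
move=> nr3 T7.
have [v _] : exists v : T, v \in T by apply/card_gt0P; rewrite T7.
pose N := [set y | r v y].
have cardN : 4 <= #|N|.
  have := cardsC N; have := nr3 v; rewrite (_ : [set y | _] = ~: N); first lia.
  by apply/setP => y; rewrite !inE.
have outside x (A : {set T}) : 3 < #|A| -> exists2 y, y \in A & r x y.
  move=> ltA; have [y yA] := exists_notin (leq_ltn_trans (nr3 x) ltA).
  by rewrite inE negbK; exists y.
case: (@matching_or_star N) => //; first by move=> x _; apply: outside.
  move=> [a [b [c [d [/and4P[]]]]]]; rewrite !inE => va vb vc vd ab cd dist.
  by exists v, a, b, c, d; rewrite dist /butterfly_at va vb vc vd ab cd.
case=> a aN ind; pose L := N :\ a.
have L3 : 3 <= #|L| by have := cardsD1 a N; rewrite aN /L; lia.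
(* The at least three leaves are mutual non-neighbours, which exhausts the bound 3. *)
have nrL b : b \in L -> L = [set y | ~~ r b y].
  move=> bL; apply/eqP; rewrite eqEcard (leq_trans (nr3 b)) // andbT.
  by apply/subsetP => y yL; rewrite inE ind.
have {}redL b y : b \in L -> y \notin L -> r b y.
  by move=> bL; rewrite (nrL b bL) inE negbK.
have [b [c [bL cL bc]]] : exists b c, [/\ b \in L, c \in L & b != c].
  by apply/card_gt1P; apply: leq_trans L3.
have va : r v a by move: aN; rewrite inE.
have aL : a \notin L by rewrite !inE eqxx.
have vL : v \notin L by rewrite !inE r_irr andbF.
have WC : 4 <= #|~: L|.
  by have := cardsC L; rewrite T7 {1}(nrL b bL); have := nr3 b; lia.
(* This [x] lies outside the link, and its neighbour [z] outside [L] completes a triangle with any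
   leaf. *)
have [x] : exists2 x, x \in ~: L & x \notin [:: v; a].
  by apply: exists_notin_seq; apply: leq_trans WC.
rewrite in_setC => xL; rewrite !inE negb_or => /andP[xv xa].
have vx : ~~ r v x by move: xL; rewrite !inE xa.
have [z] := outside x _ WC; rewrite in_setC => zL xz.
have zv : z != v by apply: contraTneq xz => ->; rewrite r_sym.
(* If [z] is [a], the triangles [a b v] and [a c x] share [a]; otherwise [b v a] and [b x z] share
   [b]. *)
have inL y u : y \in L -> u \notin L -> y != u.
  by move=> yL; apply: contraNneq => <-.
have [za|za] := eqVneq z a.
  rewrite za in xz; exists a, b, v, c, x.
  have [av ax] : r a v /\ r a x by rewrite !(r_sym a).
  have [ab ac] : r a b /\ r a c by rewrite !(r_sym a) !redL.
  rewrite /butterfly_at ab av ac ax !redL //= bc (inL b x) //=.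
  by rewrite (eq_sym v c) (eq_sym v) xv inL.
exists b, v, a, x, z; rewrite /butterfly_at va xz !redL //=.
by rewrite (eq_sym v) xv (eq_sym v) zv (eq_sym a) xa (eq_sym a).
Qed.

(** Without two disjoint edges, all edges between [A] and [B] meet at a single [a] in [A]. Another
    vertex of [A] then misses all of [B], and a vertex of [B] misses [A] minus [a], so the sizes add
    up to at most 2 + 3. *)
Lemma bipartite_matching (A B : {set T}) :
  3 <= #|A| -> 2 <= #|B| -> 6 <= #|A| + #|B| ->
  {in A, forall x, #|[set y in B | ~~ r x y]| <= 2} ->
  {in B, forall y, #|[set x in A | ~~ r x y]| <= 2} ->
  exists a b c d, [/\ [&& a \in A, b \in B, c \in A & d \in B],
     r a b, r c d, a != c & b != d].
Proof.
move=> A3 B2 AB nrA nrB.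
pose matching := exists a b c d, [/\ [&& a \in A, b \in B, c \in A & d \in B],
     r a b, r c d, a != c & b != d].
have [//|nom] := pselect matching; exfalso.
have {}nom a b c d : a \in A -> b \in B -> c \in A -> d \in B ->
    r a b -> r c d -> a != c -> b = d.
  move=> aA bB cA dB ab cd ac; apply/eqP; apply: contra_notT nom => bd.
  by exists a, b, c, d; rewrite aA bB cA dB.
have claim a b : a \in A -> b \in B -> r a b ->
    forall x y, x \in A -> y \in B -> x != a -> y != b -> ~~ r x y.
  move=> aA bB ab x y xA yB xa yb; apply: contra yb => xy.
  by rewrite (nom a b x y) // eq_sym.
have nbr b : b \in B -> exists2 a, a \in A & r a b.
  move=> bB; have [a aA] := exists_notin (leq_ltn_trans (nrB b bB) A3).
  by rewrite inE aA negbK; exists a.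
have [b bB] : exists b, b \in B by apply/card_gt0P; apply: leq_trans B2.
have [a aA ab] := nbr b bB.
have [y yB] := exists_notin_seq (B2 : size [:: b] < #|B|).
rewrite inE => yb; have [a' a'A a'y] := nbr y yB.
have ea : a' = a.
  by apply/eqP; apply: contraTT a'y => a'a; apply: (claim a b).
rewrite ea in a'y.
have [x xA] : exists2 x, x \in A & x \notin [:: a].
  by apply: exists_notin_seq; apply: leq_trans A3.
rewrite inE => xa.
have Ble : #|B| <= 2.
  apply: leq_trans (nrA x xA); apply/subset_leq_card/subsetP => z zB.
  rewrite inE zB /=; have [->|zb] := eqVneq z b; last exact: (claim a b).
  by apply: (claim a y); rewrite // eq_sym.
have Ale : #|A :\ a| <= 2.
  apply: leq_trans (nrB y yB); apply/subset_leq_card/subsetP => z /setD1P[za zA].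
  by rewrite inE zA /= (claim a b).
by have := cardsD1 a A; rewrite aA; lia.
Qed.

End NonNeighbours.

(** * Upper bounds *)

Section Upper.
Variables (j s : nat).
Let G := complete_multipartite j s.

Lemma arrows_butterfly_star :
  (forall c : {ffun {set G} -> bool},
     (forall x : G, #|[set y | colour_rel c false x y]| <= 2) ->
     has_butterfly (colour_rel c true)) ->
  arrows G butterfly (star 3).
Proof.
move=> H; apply/forallP => c; apply/orP.
have [|noblue] := boolP (contains_copy (star 3) (colour_class c false)).
  by right.
left; apply/butterfly_copyP; apply: H => x; rewrite leqNgt.
by apply: contra noblue => gt2; apply/star_copyP; exists x.
Qed.

Lemma not_red (c : {ffun {set G} -> bool}) (x y : G) :
  ~~ colour_rel c true x y = (x.1 == y.1) || colour_rel c false x y.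
Proof.
by rewrite /colour_rel /adj /= /cmp_rel; case: eqP; case: (c _).
Qed.

Lemma card_part (i : 'I_j) : #|[set y : G | i == y.1]| = s.
Proof.
rewrite -[RHS]card_ord -[RHS](card_imset _ (fun x y (e : (i, x) = (i, y)) =>
  congr1 snd e)).
apply: eq_card => -[i' k]; rewrite inE /=; apply/eqP/imsetP => [->|[? _ []//]].
by exists k.
Qed.

Lemma card_not_red (c : {ffun {set G} -> bool}) (x : G) :
  #|[set y | colour_rel c false x y]| <= 2 ->
  #|[set y | ~~ colour_rel c true x y]| <= s + 2.
Proof.
move=> le2; rewrite -[X in X + 2](card_part x.1).
apply: leq_trans (leq_add (leqnn _) le2).
apply: leq_trans (leq_card_setU _ _); apply/subset_leq_card/subsetP => y.
by rewrite !inE not_red.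
Qed.

End Upper.

(** Here [t = 3], and [butterfly_many] would ask for 8 vertices. *)
Lemma arrows_seven : arrows (complete_multipartite 7 1) butterfly (star 3).
Proof.
apply: arrows_butterfly_star => c blue2; apply: butterfly_seven.
- exact: colour_rel_sym.
- exact: colour_rel_irr.
- by move=> x; exact: card_not_red.
- by rewrite card_prod !card_ord.
Qed.

Lemma arrows_many j s : 0 < s -> s.*2 + 6 <= j * s ->
  arrows (complete_multipartite j s) butterfly (star 3).
Proof.
move=> s0 le; apply: arrows_butterfly_star => c blue2.
apply: (@butterfly_many _ _ _ _ (s + 2)).
- exact: colour_rel_sym.
- exact: colour_rel_irr.
- by move=> x; exact: card_not_red.
- by rewrite leq_addl.
- by rewrite card_prod !card_ord; lia.
Qed.

Lemma arrows_three : arrows (complete_multipartite 3 4) butterfly (star 3).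
Proof.
apply: arrows_butterfly_star => c blue2; set r := colour_rel c true.
have r_sym : symmetric r by exact: colour_rel_sym.
pose v : complete_multipartite 3 4 := (ord0, ord0).
pose N (i : 'I_3) := [set u : complete_multipartite 3 4 | (u.1 == i) && r v u].
have bipart (i k : 'I_3) : i != k ->
    {in N i, forall x, #|[set y in N k | ~~ r x y]| <= 2}.
  move=> ik x; rewrite inE => /andP[/eqP x1 _]; apply: leq_trans (blue2 x).
  apply/subset_leq_card/subsetP => y; rewrite !inE not_red -andbA.
  by case/and3P => /eqP y1 _; rewrite x1 y1 (negbTE ik).
have cardN (i : 'I_3) : i != ord0 ->
    #|N i| + #|[set u : complete_multipartite 3 4 | (u.1 == i) && ~~ r v u]| = 4.
  move=> i0; rewrite -[RHS](card_part 4 i) -cardsUI addnC.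
  rewrite (_ : _ :&: _ = set0) ?cards0.
    by apply: eq_card => u; rewrite !inE eq_sym -andb_orr orbN andbT.
  by apply/setP => u; rewrite !inE; case: (r v u); rewrite ?andbF.
pose i1 : 'I_3 := inord 1; pose i2 : 'I_3 := inord 2.
have i1E : i1 = 1 :> nat by rewrite inordK.
have i2E : i2 = 2 :> nat by rewrite inordK.
have i10 : i1 != ord0 by rewrite -val_eqE /= i1E.
have i20 : i2 != ord0 by rewrite -val_eqE /= i2E.
have i12 : i1 != i2 by rewrite -val_eqE /= i1E i2E.
(* Non-neighbours of [v] in the other two parts are blue neighbours, so at least 6 of those 8
   vertices lie in the link. *)
have blueN :
    #|[set u : complete_multipartite 3 4 | (u.1 == i1) && ~~ r v u]| +
    #|[set u : complete_multipartite 3 4 | (u.1 == i2) && ~~ r v u]| <= 2.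
  apply: leq_trans (blue2 v); rewrite -cardsUI (_ : _ :&: _ = set0).
    rewrite cards0 addn0; apply/subset_leq_card/subsetP => u; rewrite !inE not_red.
    by case/orP => /andP[/eqP ->]; rewrite eq_sym ?(negbTE i10) ?(negbTE i20).
  apply/setP => u; rewrite !inE; case: eqP => //= ->.
  by rewrite (negbTE i12) andbF.
have main i k : i != k -> 3 <= #|N i| -> 2 <= #|N k| -> 6 <= #|N i| + #|N k| ->
    has_butterfly r.
  move=> ik Ni Nk Nik.
  have nrB : {in N k, forall y, #|[set x in N i | ~~ r x y]| <= 2}.
    move=> y yk; under eq_finset do rewrite r_sym.
    by apply: (bipart k i); rewrite // eq_sym.
  have [a [b [d [e [/and4P[]]]]]] :=
    bipartite_matching Ni Nk Nik (bipart i k ik) nrB.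
  rewrite !inE => /andP[/eqP a1 va] /andP[/eqP b1 vb] /andP[/eqP d1 vd].
  case/andP => /eqP e1 ve ab de ad be; exists v, a, b, d, e.
  have dif x y : x.1 = i -> y.1 = k -> x != y.
    by move=> xi yk; apply: contraNneq ik => xy; rewrite -xi -yk xy.
  by rewrite /butterfly_at va vb ab vd ve de ad be dif // eq_sym dif.
(* Each side has at most 4 vertices and both together at least 6, so one side has at least 3 and the
   other at least 2. *)
have := cardN _ i10; have := cardN _ i20 => c2 c1.
have [N3|N2] := leqP 3 #|N i1|; first by apply: (main i1 i2); lia.
by apply: (main i2 i1); rewrite 1?eq_sym; lia.
Qed.

(** * Lower bounds by explicit colourings *)

(* The colouring is coded on pairs of natural numbers so that the conditions
   are decided by [vm_compute]. *)
Lemma not_arrows (j s : nat) (red : rel (nat * nat)) :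
  let V := [seq (i, k) | i <- iota 0 j, k <- iota 0 s] in
  let r u v := (u.1 != v.1) && red u v in
  all (fun u => all (fun v => red u v == red v u) V) V ->
  all (fun u => count (fun v => (u.1 != v.1) && ~~ red u v) V <= 2) V ->
  all (fun v => let N := filter (r v) V in
    all (fun a => all (fun b => ~~ r a b ||
      all (fun c => (c == a) || (c == b) ||
        all (fun d => [|| d == a, d == b | ~~ r c d]) N) N) N) N) V ->
  ~~ arrows (complete_multipartite j s) butterfly (star 3).
Proof.
move=> V r /allP red_sym /allP deg /allP free; pose G := complete_multipartite j s.
pose nat2 (u : G) := (u.1 : nat, u.2 : nat).
have nat2V u : nat2 u \in V.
  by apply/allpairsP; exists (nat2 u); rewrite !mem_iota /= !ltn_ord.
have nat2_inj : injective nat2 by move=> [? ?] [? ?] [/val_inj -> /val_inj ->].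
have r_sym (u w : G) : red (nat2 u) (nat2 w) = red (nat2 w) (nat2 u).
  by apply/eqP; apply: (allP (red_sym _ (nat2V u))).
(* Quantifying over both orders of the endpoints gives a colour to an unordered edge; [red] is
   symmetric on [V]. *)
pose c : {ffun {set G} -> bool} := [ffun S : {set G} =>
  [forall u in S, forall w in S, (u.1 != w.1) ==> red (nat2 u) (nat2 w)]].
have cE (u w : G) : u.1 != w.1 -> c [set u; w] = red (nat2 u) (nat2 w).
  move=> uw; rewrite ffunE; apply/forall_inP/idP => [/(_ u)|ruw x].
    rewrite !inE eqxx => /(_ isT)/forall_inP/(_ w); rewrite !inE eqxx orbT.
    by move/(_ isT); rewrite uw.
  have rwu : red (nat2 w) (nat2 u) by rewrite -r_sym.
  rewrite !inE => ux; apply/forall_inP => y; rewrite !inE.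
  by case/orP: ux => /eqP-> /orP[]/eqP->; rewrite ?eqxx ?ruw ?rwu ?implybT.
have cr (u w : G) : colour_rel c true u w = r (nat2 u) (nat2 w).
  rewrite /colour_rel /r /adj /= /cmp_rel val_eqE.
  by case: (eqVneq u.1 w.1) => //= uw; rewrite cE //; case: (red _ _).
apply/forallP => /(_ c)/orP[|].
  move=> /butterfly_copyP[v [a [b [d [e]]]]].
  rewrite /butterfly_at /adj /= !cr => /andP[/andP[va /and5P[vb ab vd ve de]]].
  case/and4P => ad ae bd be.
  have inN u : r (nat2 v) (nat2 u) -> nat2 u \in filter (r (nat2 v)) V.
    by rewrite mem_filter => ->; apply: nat2V.
  have := allP (allP (free _ (nat2V v)) _ (inN _ va)) _ (inN _ vb).
  rewrite ab /= => /allP/(_ _ (inN _ vd)); rewrite !(inj_eq nat2_inj).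
  rewrite (eq_sym d) (negbTE ad) (eq_sym d) (negbTE bd) /=.
  move/allP/(_ _ (inN _ ve)); rewrite !(inj_eq nat2_inj).
  by rewrite (eq_sym e) (negbTE ae) (eq_sym e) (negbTE be) de.
case/star_copyP => u; apply/negP; rewrite -ltnNge ltnS.
apply: leq_trans (deg _ (nat2V u)); rewrite -size_filter cardE -(size_map nat2).
apply: uniq_leq_size; first by rewrite map_inj_uniq ?enum_uniq.
move=> x /mapP[w]; rewrite mem_enum inE => /andP[uw].
rewrite cE // eqbF_neg => ruw ->.
by rewrite mem_filter nat2V andbT ruw andbT; exact: uw.
Qed.

(** Red joins the first [h] parts to the others, so there is no red triangle. Each side induces a
    blue triangle, edge or 4-cycle. *)
Lemma not_arrows_bipartite j s h :
  (j, s, h) \in [:: (6, 1, 3); (5, 1, 3); (4, 2, 2)] ->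
  ~~ arrows (complete_multipartite j s) butterfly (star 3).
Proof.
move=> jsh; apply: (@not_arrows _ _ (fun u v => (u.1 < h) != (v.1 < h)));
  by move: jsh; rewrite !inE => /or3P[] /eqP[-> -> ->]; vm_compute.
Qed.

Lemma not_arrows_three :
  ~~ arrows (complete_multipartite 3 3) butterfly (star 3).
Proof.
(* The parts are 0-2, 3-5 and 6-8; the blue graph is the cycle 0, 3, 1, 4 and the path 7, 2, 6, 5,
   8. *)
pose blue := [:: (0, 3); (0, 4); (1, 3); (1, 4); (2, 6); (2, 7); (5, 6); (5, 8)].
pose code (u : nat * nat) := u.1 * 3 + u.2.
by apply: (@not_arrows _ _ (fun u v =>
  ((code u, code v) \notin blue) && ((code v, code u) \notin blue)));
  vm_compute.
Qed.

Lemma not_arrows_empty j :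
  ~~ arrows (complete_multipartite j 0) butterfly (star 3).
Proof.
apply/forallP => /(_ [ffun=> true]).
by case/orP => /contains_copyP[f _]; case: (f ord0) => _ [].
Qed.

Theorem theorem3p6 (j : nat) (hj : 3 <= j) :
  multipartite_ramsey j butterfly (star 3) =
    Some (if j == 3 then 4
          else if j == 4 then 3
          else if (j == 5) || (j == 6) then 2
          else 1).
Proof.
case: eqP => [->|j3].
  exact: multipartite_ramsey_eq arrows_three not_arrows_three.
case: eqP => [->|j4].
  (* The bound [s.*2 + 6 <= j * s] is attained with equality here, at [j = 4] and [s = 3]. *)
  by apply: multipartite_ramsey_eq; [apply: arrows_many|
    apply: (@not_arrows_bipartite _ _ 2)].
case: ifP => [/orP[]/eqP->|j56].
- by apply: multipartite_ramsey_eq; [apply: arrows_many|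
    apply: (@not_arrows_bipartite _ _ 3)].
- by apply: multipartite_ramsey_eq; [apply: arrows_many|
    apply: (@not_arrows_bipartite _ _ 3)].
apply: multipartite_ramsey_eq; last exact: not_arrows_empty.
(* The remaining [j] are at least 7. *)
apply: arrows_mono arrows_seven; apply: complete_multipartite_mono => //.
by lia.
Qed.
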